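(* Let $p\ge 2$ be an integer. Let $f:\mathbb{R}\to\mathbb{R}^+$ be monotone non-decreasing on $(-\infty,0]$ and monotone increasing on $[0,\infty)$. Assume that $f$ is differentiable in a neighborhood of $\infty$ (there exists $M$ such that $f$ is differentiable over $(M,\infty)$) and put $\varphi_f:=f'/f$, where $f'$ is the derivative of $f$. Then: (i) If $\kappa\varphi_f(\kappa)\nearrow\infty$ as $\kappa\to\infty$, then $f$ provides high concentration. (ii) If $\kappa\varphi_f(\kappa)\to c$ as $\kappa\to\infty$ for some $c>0$, then $f$ does not provide high concentration. (iii) If $\kappa\varphi_f(\kappa)\searrow 0$ as $\kappa\to\infty$, then $f$ does not provide high concentration.
   Context: $\mathbb{R}^+$ denotes the nonnegative reals. Here $g(\kappa)\nearrow\infty$ (resp. $g(\kappa)\searrow 0$) as $\kappa\to\infty$ means that (a) $g(\kappa)$ diverges to infinity (resp. converges to zero) as $\kappa\to\infty$, and (b) there exists $M$ such that $\kappa\mapsto g(\kappa)$ is monotone non-decreasing (resp. monotone non-increasing) over $(M,\infty)$. For $\kappa>0$ let $c_{p,\kappa,f}:=1\big/\int_{-1}^1(1-s^2)^{(p-3)/2}f(\kappa s)\,ds$. The function $f$ is said to provide high concentration if, for any positive real sequence $(\kappa_n)$ diverging to infinity and any $\varepsilon\in(0,2)$, $$c_{p,\kappa_n,f}\int_{1-\varepsilon}^1(1-s^2)^{(p-3)/2}f(\kappa_n s)\,ds\to 1\quad\text{as } n\to\infty.$$ (The left-hand side is the probability ${\rm P}[\mathbf{X}'\boldsymbol\theta>1-\varepsilon]$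 when $\mathbf{X}$ is a random vector on the unit sphere of $\mathbb{R}^p$ with density, with respect to the surface area measure, proportional to $\mathbf{x}\mapsto f(\kappa_n\mathbf{x}'\boldsymbol\theta)$, for a unit vector $\boldsymbol\theta$.) *)

(* Defs.v *)
From HB Require Import structures.
From mathcomp Require Import all_boot all_order all_algebra.
From mathcomp Require Import all_classical all_reals all_analysis.

Set Implicit Arguments.
Unset Strict Implicit.
Unset Printing Implicit Defensive.

Import Order.TTheory GRing.Theory Num.Theory.
Import numFieldNormedType.Exports.

Local Open Scope classical_set_scope.
Local Open Scope ring_scope.

Definition nondecreasing_to_pinfty (R : realType) (g : R -> R) : Prop :=
  (g x @[x --> +oo] --> +oo) /\
  exists M : R, {in `]M, +oo[ &, {homo g : x y / x <= y}}.

Definition nonincreasing_to_zero (R : realType) (g : R -> R) : Prop :=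
  (g x @[x --> +oo] --> 0) /\
  exists M : R, {in `]M, +oo[ &, {homo g : x y / x <= y >-> y <= x}}.

Definition phi (R : realType) (f : R -> R) (x : R) : R := derive1 f x / f x.

(* For p = 2 the weight is unbounded near -1 and 1, where the library sets it
   to 0 (0 `^ a = 0 for a != 0); the two endpoints are Lebesgue-negligible. *)
Definition weighted (R : realType) (p : nat) (kappa : R) (f : R -> R) (s : R)
    : R :=
  (1 - s ^+ 2) `^ ((p%:R - 3) / 2) * f (kappa * s).

Definition cst_pkf (R : realType) (p : nat) (kappa : R) (f : R -> R) : R :=
  1 / \int[lebesgue_measure]_(s in `[-1, 1]) weighted p kappa f s.

Definition high_concentration (R : realType) (p : nat) (f : R -> R) : Prop :=
  forall kappa : nat -> R,
    (forall n, 0 < kappa n) ->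
    kappa n @[n --> \oo] --> +oo ->
    forall eps : R, 0 < eps < 2 ->
      (cst_pkf p (kappa n) f *
        \int[lebesgue_measure]_(s in `[1 - eps, 1]) weighted p (kappa n) f s)
        @[n --> \oo] --> (1 : R).

(* Main.v *)
(* Split the mass of the weighted density at 1 - eps into L (below) and N
   (above), so that the probability is N / (L + N).  The mean value theorem for
   ln f gives, for x < y, some c in ]x, y[ with
     ln f(y) - ln f(x) = c phi(c) * (y - x) / c.
   If kappa phi(kappa) diverges, then f(kappa c) / f(kappa d) -> 0 for all
   0 < c < d; as f is nondecreasing, L is bounded by a multiple of f(kappa c)
   and N is bounded below by a multiple of f(kappa d) for some c < d, so
   L / N -> 0.  If kappa phi(kappa) is eventually bounded, which covers (ii) and
   (iii), then f(kappa) <= E f(kappa / 4) for large kappa, so N is at most a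
   fixed multiple of L and the probability stays away from 1. *)
Require Import Defs.
From HB Require Import structures.
From mathcomp Require Import all_boot all_order all_algebra.
From mathcomp Require Import all_classical all_reals all_analysis.
From mathcomp Require Import measurable_realfun.
From mathcomp Require Import ring lra.

Set Implicit Arguments.
Unset Strict Implicit.
Unset Printing Implicit Defensive.

Import Order.TTheory GRing.Theory Num.Theory.
Import numFieldNormedType.Exports.

Local Open Scope classical_set_scope.
Local Open Scope ring_scope.

(** The factor of [weighted] that involves neither f nor kappa. The exponent is left free so that
    different exponents can be compared. *)
Definition weight {R : realType} (a s : R) : R := (1 - s ^+ 2) `^ a.

(** * Monotonicity of f and increments of ln f *)

Lemma homo_le_glue {R : realType} (f : R -> R) :
  {in `]-oo, 0] &, {homo f : x y / x <= y}} ->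
  {in `[0, +oo[ &, {homo f : x y / x < y}} ->
  {homo f : x y / x <= y}.
Proof.
move=> fN fP x y xy.
have fP' : {in `[0, +oo[ &, {homo f : x y / x <= y}} by apply: ltW_homo_in.
have [x0|/ltW x0] := leP x 0; last first.
  by apply: fP' => //; rewrite in_itv/= andbT// (le_trans x0).
have [y0|/ltW y0] := leP y 0; first by apply: fN; rewrite ?in_itv.
by apply: (@le_trans _ _ (f 0)); [apply: fN|apply: fP']; rewrite ?in_itv/= ?andbT.
Qed.

(** The derivative of ln f is [phi f]. The factor [c * phi f c] is set apart because it is the
    quantity whose limit is prescribed; [0 <= M] forces c > 0, so dividing by c is harmless. *)
Lemma ln_increment {R : realType} (f : R -> R) (M x y : R) :
  (forall z : R, M < z -> derivable f z 1) -> (forall z : R, M < z -> 0 < f z) ->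
  0 <= M -> M < x -> x < y ->
  exists2 c, x < c < y & ln (f y) - ln (f x) = c * phi f c * ((y - x) / c).
Proof.
move=> df f0 M0 Mx xy.
have dlnf z : M < z -> is_derive z 1 (@ln R \o f) (phi f z).
  move=> Mz; have := is_derive1_ln (f0 _ Mz) => dln.
  have dfz : is_derive z 1 f (derive1 f z).
    by rewrite derive1E; apply/derivableP/df.
  by rewrite /phi mulrC; apply: is_derive1_comp.
have [c] : exists2 c, c \in `]x, y[%R &
    (@ln R \o f) y - (@ln R \o f) x = phi f c * (y - x).
  apply: MVT => //.
    by move=> z; rewrite in_itv/= => /andP[xz _]; apply: dlnf; apply: lt_trans xz.
  apply: derivable_within_continuous => z; rewrite in_itv/= => /andP[xz _].
  by apply: ex_derive; apply: dlnf; apply: lt_le_trans xz.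
rewrite in_itv/= => cxy ->; exists c => //.
have c0 : c != 0.
  by case/andP: cxy => xc _; rewrite gt_eqF// (le_lt_trans M0)// (lt_trans Mx).
by field.
Qed.

(** * Continuity, integrability and mass of the weight *)

Lemma measurable_weight {R : realType} (a : R) (D : set R) :
  measurable_fun D (weight a).
Proof.
apply: measurable_funTS; rewrite [weight a](_ : _ = (@powR R ^~ a) \o (fun s => 1 - s ^+ 2))//.
apply: measurableT_comp => //.
exact: measurable_funB.
Qed.

Lemma continuous_weight {R : realType} (a s : R) :
  -1 < s < 1 -> {for s, continuous (weight a)}.
Proof.
move=> s1; apply/differentiable_continuous; rewrite -derivable1_diffP.
have s0 : 0 < 1 - s ^+ 2 by nra.
have := is_derive1_powR a s0 => dp.
have dq : derivable (fun s : R => 1 - s ^+ 2) s 1.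
  by apply: derivableB => //; apply: exprn_derivable.
by have [] := @is_derive1_comp _ (@powR R ^~ a) (fun s => 1 - s ^+ 2) s _ _ dp (derivableP dq).
Qed.

(** The endpoints are included: there both sides are 0, by the conventions for powers and inverses
    of 0. *)
Lemma weight_inv_sqrt {R : realType} (s : R) :
  -1 <= s <= 1 -> weight (- 2^-1) s = (Num.sqrt (1 - s ^+ 2))^-1.
Proof. by move=> s1; rewrite /weight powRN powR12_sqrt//; nra. Qed.

(* [weight (- 2^-1)] is the derivative of [asin]; the improper integral is
   reached by monotone convergence along the segments [F n]. *)
Lemma weight_inv_sqrt_integral_lty {R : realType} :
  (\int[lebesgue_measure]_(s in `]((-1)%R : R), 1%R[) (weight (- 2^-1) s)%:E
   < +oo)%E.
Proof.
(* The shift by 2 gives [r 0 = 1/2], so every segment [F n] has positive length, as the fundamental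
   theorem of calculus requires. *)
pose r (n : nat) : R := 1 - n.+2%:R^-1.
pose g : R -> R := weight (- 2^-1).
pose F (n : nat) : set R := `[- r n, r n]%classic.
have r01 n : 0 < r n < 1.
  rewrite /r subr_gt0 invf_lt1 ?ltr0n// ltr1n/=.
  by rewrite ltrBlDr ltrDl invr_gt0 ltr0n.
have UF : \bigcup_n F n = `](-1 : R), 1[%classic.
  apply/seteqP; split => [x [n _]|x]; rewrite /F/= !in_itv/=.
    by have := r01 n; lra.
  move=> x1.
  have e0 : 0 < 1 - `|x| by rewrite subr_gt0 ltr_norml.
  have := @near_infty_natSinv_lt R (PosNum e0).
  move=> [n _ /(_ n.+1)]/= /(_ (leqnSn _)) nx.
  by exists n => //; rewrite /F/= in_itv/= -ler_norml /r lerBrDl -lerBrDr ltW.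
rewrite -UF.
have ndF : nondecreasing_seq F.
  move=> m n mn; rewrite subsetEset => x; rewrite /F/= !in_itv/= -!ler_norml.
  move=> /le_trans; apply; rewrite /r lerB// lef_pV2 ?posrE ?ltr0n//.
  by rewrite ler_nat.
have Fpi n : (\int[lebesgue_measure]_(s in F n) (g s)%:E <= pi%:E)%E.
  have /andP[r0 r1] := r01 n.
  have dasin x : x \in `[- r n, r n] -> is_derive x 1 (@asin R) (g x).
    rewrite in_itv/= => xr; rewrite /g weight_inv_sqrt; last lra.
    by apply: is_derive1_asin; lra.
  have casin x : x \in `[- r n, r n] -> {for x, continuous (@asin R)}.
    by rewrite in_itv/= => xr; apply: continuous_asin; lra.
  rewrite (@continuous_FTC2 _ g asin)//.
  - rewrite -EFinB lee_fin.
    have : asin (r n) <= pi / 2 :> R by apply: asin_lepi2; lra.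
    have : - (pi / 2) <= asin (- r n) :> R by apply: asin_geNpi2; lra.
    lra.
  - lra.
  - apply: continuous_in_subspaceT => x; rewrite inE/= in_itv/= => xr.
    by apply: continuous_weight; lra.
  - split.
    + move=> x xr; apply: ex_derive; apply: dasin.
      exact: subset_itv_oo_cc.
    + apply: cvg_at_right_filter; apply: casin; rewrite in_itv/=; lra.
    + apply: cvg_at_left_filter; apply: casin; rewrite in_itv/=; lra.
  - move=> x xr; rewrite derive1E; apply: derive_val; apply: dasin.
    exact: subset_itv_oo_cc.
apply: (@le_lt_trans _ _ pi%:E); last exact: ltry.
have cv : (\int[lebesgue_measure]_(s in F n) (g s)%:E @[n --> \oo] -->
           \int[lebesgue_measure]_(s in \bigcup_n F n) (g s)%:E)%E.
  apply: ge0_nondecreasing_set_cvg_integral => //.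
  - by move=> n; exact: measurable_itv.
  - by move=> n; apply/measurable_EFinP; exact: measurable_weight.
  - by move=> n x _; rewrite lee_fin powR_ge0.
rewrite -(cvg_lim _ cv)//; apply: lime_le; first by apply/cvg_ex; eexists; exact: cv.
by apply: nearW => n; apply: Fpi.
Qed.

(** The base [1 - s ^+ 2] lies in [0, 1], where powers decrease in the exponent; the exponent -1/2,
    which is the case p = 2, therefore dominates. *)
Lemma integrable_weight {R : realType} (a : R) : - 2^-1 <= a ->
  (@lebesgue_measure R).-integrable `[-1, 1] (EFin \o weight a).
Proof.
move=> a2; apply/integrableP; split.
  by apply/measurable_EFinP; exact: measurable_weight.
have mw b D : measurable_fun D (fun s : R => (weight b s)%:E).
  by apply/measurable_EFinP; exact: measurable_weight.
under eq_integral => s _ do rewrite /= ger0_norm ?powR_ge0//.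
rewrite integral_itv_bndoo//; apply: le_lt_trans (@weight_inv_sqrt_integral_lty R).
apply: ge0_le_integral => //.
- by move=> s _; rewrite lee_fin powR_ge0.
- exact: mw.
- exact: mw.
- move=> s /=; rewrite in_itv/= lee_fin => s1.
  by apply: ger_powR => //; nra.
Qed.

Lemma sub_itvcc {R : realType} (x y : R) :
  -1 <= x -> y <= 1 -> `[x, y]%classic `<=` (`[-1, 1]%classic : set R).
Proof. by move=> x1 y1 s /=; rewrite !in_itv/= => sxy; lra. Qed.

Lemma integrable_weightS {R : realType} (a x y : R) :
  - 2^-1 <= a -> -1 <= x -> y <= 1 ->
  (@lebesgue_measure R).-integrable `[x, y] (EFin \o weight a).
Proof.
move=> a2 x1 y1; apply: (@integrableS _ _ R lebesgue_measure `[-1, 1]%classic) => //.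
  exact: sub_itvcc.
exact: integrable_weight.
Qed.

Lemma weight_mass_gt0 {R : realType} (a x y : R) :
  - 2^-1 <= a -> 0 <= x -> x < y -> y < 1 ->
  0 < \int[lebesgue_measure]_(s in `[x, y]) weight a s.
Proof.
(* The exponent `|a| makes m a lower bound whatever the sign of a. *)
move=> a2 x0 xy y1; pose m : R := (1 - y ^+ 2) `^ `|a|.
have m0 : 0 < m by apply: powR_gt0; nra.
apply: (@lt_le_trans _ _ (\int[lebesgue_measure]_(s in `[x, y]) m)).
  rewrite Rintegral_cst//= lebesgue_measure_itv/= lte_fin xy/=.
  by rewrite mulr_gt0// subr_gt0.
apply: le_Rintegral => //.
- apply/integrableP; split; first exact/measurable_EFinP.
  by rewrite integral_cst//= lebesgue_measure_itv/= lte_fin xy/= -EFinM ltry.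
- by apply: integrable_weightS => //; lra.
- move=> s /=; rewrite in_itv/= => sxy.
  have s2 : 0 < 1 - s ^+ 2 <= 1 by nra.
  apply: (@le_trans _ _ ((1 - s ^+ 2) `^ `|a|)).
    by apply: ge0_ler_powR => //; rewrite ?nnegrE; nra.
  by apply: ger_powR => //; exact: ler_norm.
Qed.

(** * Integrals of the weighted density and two concentration criteria *)

Section weighted_integrals.
Context {R : realType} (p : nat) (f : R -> R).
Hypotheses (hp : (2 <= p)%N) (f_ge0 : forall x, 0 <= f x)
  (f_nd : {homo f : x y / x <= y}).
Notation mu := (@lebesgue_measure R).
Local Notation a := ((p%:R - 3) / 2 : R).

Let a2 : - 2^-1 <= a.
Proof. by have : 2 <= p%:R :> R; [rewrite ler_nat|lra]. Qed.

(** Monotonicity of f gives both measurability and, as [k * s <= k] on [-1, 1], domination by [f k]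
    times the weight. *)
Lemma integrable_weighted (k x y : R) : 0 <= k -> -1 <= x -> y <= 1 ->
  mu.-integrable `[x, y] (EFin \o weighted p k f).
Proof.
move=> k0 x1 y1; apply: (@integrableS _ _ R lebesgue_measure `[-1, 1]%classic) => //.
  exact: sub_itvcc.
have mW : measurable_fun [set: R] (weighted p k f).
  apply: measurable_funM; first exact: measurable_weight.
  apply: nondecreasing_measurable => // s t st.
  by apply: f_nd; apply: ler_wpM2l.
have iW := integrable_weight a2.
have {}iW : mu.-integrable `[-1, 1] (fun s => (f k)%:E * (weight a s)%:E)%E.
  exact: integrableZl.
apply: le_integrable iW => //.
  by apply/measurable_EFinP; apply: measurable_funTS.
move=> s /=; rewrite in_itv/= => s1; rewrite lee_fin.
rewrite /weighted -/(weight _ _) !ger0_norm ?mulr_ge0 ?powR_ge0//.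
by rewrite mulrC ler_wpM2r ?powR_ge0// f_nd// ler_piMr//; lra.
Qed.

(** The weight is integrated over all of [-1, 1] on the right so that the constant depends on
    neither x nor y. *)
Lemma weighted_le (k x y : R) : 0 <= k -> -1 <= x -> y <= 1 ->
  \int[mu]_(s in `[x, y]) weighted p k f s <=
  f (k * y) * \int[mu]_(s in `[-1, 1]) weight a s.
Proof.
move=> k0 x1 y1.
have iw : mu.-integrable `[x, y] (EFin \o weight a).
  exact: integrable_weightS.
apply: (@le_trans _ _ (f (k * y) * \int[mu]_(s in `[x, y]) weight a s)).
  rewrite -RintegralZl//; apply: le_Rintegral => //.
  - exact: integrable_weighted.
  - exact: (integrableZl _ _ iw).
  - move=> s /=; rewrite in_itv/= => /andP[_ sy].
    by rewrite /weighted mulrC ler_wpM2r ?powR_ge0// f_nd// ler_wpM2l.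
rewrite ler_wpM2l// fine_le//.
- exact: integrable_fin_num.
- by apply: integrable_fin_num => //; exact: integrable_weight.
- apply: ge0_subset_integral => //.
  + by apply/measurable_EFinP; exact: measurable_weight.
  + by move=> s _; rewrite lee_fin powR_ge0.
  + exact: sub_itvcc.
Qed.

Lemma weighted_ge (k x y : R) : 0 <= k -> -1 <= x -> y <= 1 ->
  f (k * x) * \int[mu]_(s in `[x, y]) weight a s <=
  \int[mu]_(s in `[x, y]) weighted p k f s.
Proof.
move=> k0 x1 y1.
have iw : mu.-integrable `[x, y] (EFin \o weight a).
  exact: integrable_weightS.
rewrite -RintegralZl//; apply: le_Rintegral => //.
- exact: (integrableZl _ _ iw).
- exact: integrable_weighted.
- move=> s /=; rewrite in_itv/= => /andP[xs _].
  by rewrite /weighted mulrC ler_wpM2l ?powR_ge0// f_nd// ler_wpM2l.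
Qed.

Lemma weighted_subset (k x y z t : R) : 0 <= k -> -1 <= x -> x <= z -> t <= y ->
  y <= 1 ->
  \int[mu]_(s in `[z, t]) weighted p k f s <=
  \int[mu]_(s in `[x, y]) weighted p k f s.
Proof.
move=> k0 x1 xz ty y1; rewrite fine_le//.
- by apply: integrable_fin_num => //; apply: integrable_weighted; lra.
- by apply: integrable_fin_num => //; apply: integrable_weighted; lra.
- apply: ge0_subset_integral => //.
  + have /integrableP[//] := integrable_weighted k0 x1 y1.
  + by move=> s _; rewrite lee_fin mulr_ge0// powR_ge0.
  + by move=> s /=; rewrite !in_itv/=; lra.
Qed.

Lemma weighted_split (k x : R) : 0 <= k -> -1 <= x <= 1 ->
  \int[mu]_(s in `[-1, 1]) weighted p k f s =
  \int[mu]_(s in `[-1, x]) weighted p k f s +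
  \int[mu]_(s in `[x, 1]) weighted p k f s.
Proof.
move=> k0 x1.
have iW := @integrable_weighted k (-1) 1 k0 (lexx _) (lexx _).
(* The point x lies in both segments; opening the second one at x leaves its integral unchanged and
   makes the two disjoint. *)
rewrite -(@Rintegral_itv_obnd_cbnd _ x); last first.
  apply: integrableS iW => // s /=; rewrite !in_itv/=; lra.
rewrite -(@Rintegral_itvB _ _ (BLeft (-1)) (BRight 1) x) ?bnd_simp//; last 2 first.
  by case/andP: x1.
  by case/andP: x1.
by ring.
Qed.

Lemma high_concentration_of_ratio :
  (forall x : R, 0 < x -> 0 < f x) ->
  (forall c d : R, 0 < c -> c < d -> f (k * c) / f (k * d) @[k --> +oo] --> (0 : R)) ->
  high_concentration p f.
Proof.
move=> f_gt0 ratio0 k k0 koo e e02.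
(* Since [1 - e] may be negative, it is replaced by a larger c that is at least 1/2; d is the
   midpoint of c and 1. *)
pose c := 1 - Num.min e 2^-1; pose d := (1 + c) / 2.
have [c0 cd d1 ec] : [/\ 0 < c, c < d, d < 1 & 1 - e <= c].
  by rewrite /d/c minEle; case: ifPn => he; split; lra.
pose W := \int[mu]_(s in `[-1, 1]) weight a s.
(* The segment stops short of 1, as [weight_mass_gt0] requires. *)
pose w := \int[mu]_(s in `[d, (1 + d) / 2]) weight a s.
have w0 : 0 < w by apply: weight_mass_gt0 => //; lra.
have lim1 : (1 - W / w * (f (k n * c) / f (k n * d))) @[n --> \oo] --> (1 : R).
  rewrite -[X in _ --> X]subr0; apply: cvgB; first exact: cvg_cst.
  rewrite -[X in _ --> X](mulr0 (W / w)); apply: cvgMr.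
  exact: cvg_comp koo (ratio0 _ _ c0 cd).
apply: squeeze_cvgr lim1 (cvg_cst (1 : R)).
near=> n; rewrite /cst_pkf.
have kn0 := ltW (k0 n).
have f0 : 0 < f (k n * d) by apply: f_gt0; rewrite mulr_gt0//; lra.
have e1 : -1 <= 1 - e <= 1 by lra.
rewrite (weighted_split kn0 e1).
set L := \int[mu]_(s in `[-1, 1 - e]) _; set N := \int[mu]_(s in `[1 - e, 1]) _.
have L0 : 0 <= L.
  by apply: Rintegral_ge0 => s _; rewrite mulr_ge0// powR_ge0.
have LW : L <= f (k n * c) * W.
  apply: le_trans (weighted_le _ _ _) _ => //; first lra.
  rewrite ler_wpM2r//; last by rewrite f_nd// ler_wpM2l.
  by apply: Rintegral_ge0 => s _; rewrite powR_ge0.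
have wN : f (k n * d) * w <= N.
  apply: le_trans (weighted_ge _ _ _) _ => //; try lra.
  by apply: weighted_subset => //; lra.
have fw0 : 0 < f (k n * d) * w by rewrite mulr_gt0.
have N0 : 0 < N by apply: lt_le_trans wN.
have -> : 1 / (L + N) * N = 1 - L / (L + N) by field; lra.
(* The numerator is enlarged by [LW], and the denominator is reduced by [L0] and [wN]. *)
have LN : L / (L + N) <= W / w * (f (k n * c) / f (k n * d)).
  have -> : W / w * (f (k n * c) / f (k n * d)) =
      (f (k n * c) * W) / (f (k n * d) * w) by field; lra.
  by apply: ler_pM => //; rewrite ?invr_ge0 ?lef_pV2 ?posrE; lra.
have LN0 : 0 <= L / (L + N) by rewrite divr_ge0//; lra.
by apply/andP; split; lra.
Unshelve. all: by end_near. Qed.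

Local Notation W := (\int[mu]_(s in `[-1, 1]) weight a s).
Local Notation w := (\int[mu]_(s in `[4^-1, 2^-1]) weight a s).

(** Here epsilon = 1/2. The mass above 1/2 is at most [f k * W], and the mass below is at least the
    part on [1/4, 1/2], hence at least [f (k * 4^-1) * w]. So [N <= B * L] with [B = W * E / w], and
    N / (L + N) is at most B / (1 + B). *)
Lemma upper_mass_le (k E : R) : 0 < k -> 0 <= E -> 0 < f (k * 4^-1) ->
  f k <= E * f (k * 4^-1) ->
  cst_pkf p k f * \int[mu]_(s in `[1 - 2^-1, 1]) weighted p k f s <=
  W * E / w / (1 + W * E / w).
Proof.
move=> k0 E0 f0 fE.
have x1 : -1 <= (1 - 2^-1 : R) <= 1 by lra.
have w0 : 0 < w by apply: weight_mass_gt0 => //; lra.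
have W0 : 0 <= W by apply: Rintegral_ge0 => s _; rewrite powR_ge0.
set B := W * E / w; have B0 : 0 <= B by apply: divr_ge0; [exact: mulr_ge0|exact: ltW].
rewrite /cst_pkf (weighted_split (ltW k0) x1).
set L := \int[mu]_(s in `[-1, 1 - 2^-1]) _.
set N := \int[mu]_(s in `[1 - 2^-1, 1]) _.
have NW : N <= f k * W.
  by have := @weighted_le k (1 - 2^-1) 1; rewrite mulr1; apply; lra.
have wL : f (k * 4^-1) * w <= L.
  by apply: le_trans (weighted_ge _ _ _) (weighted_subset _ _ _ _ _); lra.
have N0 : 0 <= N.
  by apply: Rintegral_ge0 => s _; rewrite mulr_ge0// powR_ge0.
have L0 : 0 < L by apply: lt_le_trans wL; rewrite mulr_gt0.
have NL : N <= B * L.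
  apply: (le_trans NW); apply: (@le_trans _ _ (B * (f (k * 4^-1) * w))).
    have -> : B * (f (k * 4^-1) * w) = E * f (k * 4^-1) * W.
      by rewrite /B; field; rewrite gt_eqF.
    by rewrite ler_wpM2r.
  by rewrite ler_wpM2l.
(* Clearing denominators leaves [N * (1 + B) <= B * (L + N)], which is [NL] after cancelling
   [B * N]. *)
clearbody B L N; rewrite mul1r mulrC ler_pdivrMr; last lra.
rewrite mulrAC ler_pdivlMr; last lra.
by rewrite mulrDr mulr1 mulrDr [B * N]mulrC; lra.
Qed.

Lemma not_high_concentration_of_ratio (E : R) :
  0 <= E -> (forall x : R, 0 < x -> 0 < f x) ->
  (\forall k \near +oo, f k <= E * f (k * 4^-1)) ->
  ~ high_concentration p f.
Proof.
move=> E0 f_gt0 fE hc.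
have e02 : 0 < (2^-1 : R) < 2 by lra.
(* The test sequence is n + 1, which is positive already at n = 0. *)
have koo : (n.+1%:R : R) @[n --> \oo] --> +oo.
  by rewrite (cvg_shiftS (fun n => n%:R : R)); exact: cvgr_idn.
have /= lim1 := hc (fun n => n.+1%:R) (fun n => ltr0Sn R n) koo _ e02.
set B := W * E / w.
have B0 : 0 <= B.
  by apply: divr_ge0; [apply: mulr_ge0 => //|];
    apply: Rintegral_ge0 => s _; rewrite powR_ge0.
(* The bound B / (1 + B) is uniform in n and below 1, so it contradicts the limit 1. *)
suff : 1 <= B / (1 + B) by rewrite ler_pdivlMr; lra.
apply: (cvgr_to_le lim1); near=> n; apply: upper_mass_le => //.
- by apply: f_gt0; rewrite mulr_gt0.
- by near: n; exact: (koo _ fE).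
Unshelve. all: by end_near. Qed.

End weighted_integrals.

(** * From the behaviour of kappa phi(kappa) to ratios of values of f *)

Lemma ratio_cvg0 {R : realType} (f : R -> R) (M : R) :
  (forall x : R, M < x -> derivable f x 1) -> (forall x : R, 0 < x -> 0 < f x) ->
  k * phi f k @[k --> +oo] --> +oo ->
  forall c d : R, 0 < c -> c < d -> f (k * c) / f (k * d) @[k --> +oo] --> (0 : R).
Proof.
move=> df f0 phioo c d c0 cd; apply/cvgrPdist_le => e e0.
(* For z < k d, (k d - k c) / z exceeds 1 - c / d. With this A, the bound [A <= z * phi f z] makes
   ln f grow by at least [|ln e|] from k c to k d, which bounds the ratio by e. *)
pose A := `|ln e| / (1 - c / d).
have d0 := lt_trans c0 cd.
have cd1 : 0 < 1 - c / d by rewrite subr_gt0 ltr_pdivrMr ?mul1r.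
have A0 : 0 <= A by rewrite divr_ge0// ltW.
have [M1 [_ phiA]] : \forall k \near +oo, A <= k * phi f k.
  by move/cvgryPge : phioo; apply.
pose N := Num.max 0 (Num.max M M1).
have [N0 MN M1N] : [/\ 0 <= N, M <= N & M1 <= N].
  by rewrite /N !le_max !lexx !orbT.
near=> k.
have Nk : N / c < k by near: k; apply: nbhs_pinfty_gt; rewrite num_real.
have k0 : 0 < k by apply: le_lt_trans Nk; rewrite divr_ge0// ltW.
have Nkc : N < k * c by rewrite -ltr_pdivrMr.
have kcd : k * c < k * d by rewrite ltr_pM2l.
have [||z /andP[kcz zkd] eq] := @ln_increment R f N _ _ _ _ N0 Nkc kcd.
- by move=> z Nz; apply: df; apply: le_lt_trans Nz.
- by move=> z Nz; apply: f0; apply: le_lt_trans Nz.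
have fc0 : 0 < f (k * c) by rewrite f0// mulr_gt0.
have fd0 : 0 < f (k * d) by rewrite f0// mulr_gt0.
have kd0 : 0 < k * d by rewrite mulr_gt0.
have z0 : 0 < z by apply: lt_trans kcz; rewrite mulr_gt0.
have fcd0 : 0 <= f (k * c) / f (k * d) by rewrite divr_ge0// ltW.
rewrite sub0r normrN ger0_norm//.
rewrite ler_pdivrMr// -ler_ln ?posrE ?mulr_gt0// lnM ?posrE//.
have Az : A <= z * phi f z.
  by apply: phiA; apply: le_lt_trans M1N _; apply: lt_trans kcz.
suff : `|ln e| <= z * phi f z * ((k * d - k * c) / z).
  rewrite -eq; have := ler_norm (- ln e); rewrite normrN; lra.
have -> : `|ln e| = A * ((k * d - k * c) / (k * d)).
  by rewrite /A; field; rewrite !gt_eqF//=; lra.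
apply: ler_pM => //.
  by rewrite divr_ge0// ?subr_ge0 ltW.
by rewrite ler_pM2l ?subr_gt0// lef_pV2 ?posrE// ltW.
Unshelve. all: by end_near. Qed.

(** The factor 3 arises from z > k / 4, which gives (k - k / 4) / z <= 3. The absolute value of C
    keeps the bound nonnegative, so that the two estimates can be multiplied. *)
Lemma ratio_bounded {R : realType} (f : R -> R) (M C : R) :
  (forall x : R, M < x -> derivable f x 1) -> (forall x : R, 0 < x -> 0 < f x) ->
  (\forall k \near +oo, k * phi f k <= C) ->
  \forall k \near +oo, f k <= expR (`|C| * 3) * f (k * 4^-1).
Proof.
move=> df f0 [M1 [_ phiC]].
pose N := Num.max 0 (Num.max M M1).
have [N0 MN M1N] : [/\ 0 <= N, M <= N & M1 <= N].
  by rewrite /N !le_max !lexx !orbT.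
near=> k.
have Nk : N * 4 < k by near: k; apply: nbhs_pinfty_gt; rewrite num_real.
have k0 : 0 < k by apply: le_lt_trans Nk; rewrite mulr_ge0.
have Nkc : N < k * 4^-1 by lra.
have kcd : k * 4^-1 < k by lra.
have [||z /andP[kcz zk] eq] := @ln_increment R f N _ _ _ _ N0 Nkc kcd.
- by move=> z Nz; apply: df; apply: le_lt_trans Nz.
- by move=> z Nz; apply: f0; apply: le_lt_trans Nz.
have fk0 : 0 < f k by rewrite f0.
have f4 : 0 < f (k * 4^-1) by rewrite f0// mulr_gt0.
have z0 : 0 < z by lra.
rewrite -ler_ln ?posrE ?mulr_gt0 ?expR_gt0// lnM ?posrE ?expR_gt0// expRK.
have Cz : z * phi f z <= `|C|.
  apply: le_trans (ler_norm _); apply: phiC.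
  by apply: le_lt_trans M1N _; apply: lt_trans kcz.
suff : z * phi f z * ((k - k * 4^-1) / z) <= `|C| * 3 by rewrite -eq; lra.
have t0 : 0 <= (k - k * 4^-1) / z by rewrite divr_ge0//; lra.
apply: (le_trans (ler_wpM2r t0 Cz)); rewrite ler_wpM2l//.
by rewrite ler_pdivrMr//; lra.
Unshelve. all: by end_near. Qed.

Theorem theorem2p1 (R : realType) (p : nat) (hp : (2 <= p)%N) (f : R -> R)
    (f_ge0 : forall x : R, 0 <= f x)
    (f_nondecr : {in `]-oo, 0] &, {homo f : x y / x <= y}})
    (f_incr : {in `[0, +oo[ &, {homo f : x y / x < y}})
    (f_diff : exists M : R, forall x : R, M < x -> derivable f x 1) :
  [/\ nondecreasing_to_pinfty (fun kappa => kappa * phi f kappa) ->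
        high_concentration p f,
      forall c : R, 0 < c ->
        kappa * phi f kappa @[kappa --> +oo] --> c ->
        ~ high_concentration p f
    & nonincreasing_to_zero (fun kappa => kappa * phi f kappa) ->
        ~ high_concentration p f].
Proof.
have f_nd := homo_le_glue f_nondecr f_incr.
have f_gt0 (x : R) : 0 < x -> 0 < f x.
  move=> x0; apply: (le_lt_trans (f_ge0 0)); apply: f_incr => //.
    by rewrite in_itv/= lexx.
  by rewrite in_itv/= andbT ltW.
have [M df] := f_diff.
(* Cases (ii) and (iii) share this argument: convergence to a finite l yields the eventual bound l +
   1. *)
have not_hc (l : R) : kappa * phi f kappa @[kappa --> +oo] --> l ->
    ~ high_concentration p f.
  move=> phil; have phiC : \forall k \near +oo, k * phi f k <= l + 1.
    by apply: (cvgr_le l phil); rewrite ltrDl.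
  exact: not_high_concentration_of_ratio (expR_ge0 _) _ (ratio_bounded df f_gt0 phiC).
split=> [[phioo _]|c _|[phi0 _]].
- exact: high_concentration_of_ratio (ratio_cvg0 df f_gt0 phioo).
- exact: not_hc.
- exact: not_hc phi0.
Qed.
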